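(* Let $(Z,\|\cdot\|_Z)$ and $(E,\|\cdot\|_E)$ be Banach spaces, let $\|\cdot\|_{Z_s}$ and $\|\cdot\|_{E_s}$ be equivalent norms on $Z$ and $E$, respectively, and set $Z_s:=(Z,\|\cdot\|_{Z_s})$ and $E_s:=(E,\|\cdot\|_{E_s})$. Let $L_r'\colon Z\to E$ be a (nonlinear) map and define $G\colon Z\times E\to E$ by $G(z,\varepsilon):=L_r'(z)-\varepsilon$. Let $(z^0,\varepsilon^0)\in Z\times E$ satisfy $G(z^0,\varepsilon^0)=0$, and denote by $G_z(z^0,\varepsilon^0)\in L(Z,E)$ the derivative of $G$ with respect to $z$ at $(z^0,\varepsilon^0)$. Assume: (i) $G_z(z^0,\varepsilon^0)\in L(Z,E)$ is continuously invertible. (ii) $$\delta_\varepsilon(z^1,z^2):=\frac{\|G(z^1,\varepsilon)-G(z^2,\varepsilon)-G_z(z^0,\varepsilon^0)(z^1-z^2)\|_E}{\|z^1-z^2\|_Z}\to 0$$ if $z^1,z^2\to z^0$ in $Z$ (with $z^1\ne z^2$) and $\varepsilon\to\varepsilon^0$ in $E$. (iii) $$\delta^s_\varepsilon(z^1,z^0):=\frac{\|G(z^1,\varepsilon)-G(z^0,\varepsilon)-G_z(z^0,\varepsilon^0)(z^1-z^0)\|_{E_s}}{\|z^1-z^0\|_{Z_s}}\to 0$$ if $z^1\to z^0$ in $Z$ (with $z^1\neq z^0$) and $\varepsilon\to\varepsilon^0$ in $E$. Then there are $r_E,r_Z>0$ and a constant $c$ such that for every $\varepsilon\in E$ with $\|\varepsilon-\varepsilon^0\|_E\le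 r_E$ there exists $z^*(\varepsilon)\in Z$ with $\|z^*(\varepsilon)-z^0\|_Z\le r_Z$, $G(z^*(\varepsilon),\varepsilon)=0$, and $$\|z^*(\varepsilon)-z^0\|_{Z_s}\le c\,\|\varepsilon-\varepsilon^0\|_{E_s}.\qquad( * )$$ Moreover, if the spaces $Z,E$, the norms $\|\cdot\|_Z,\|\cdot\|_E,\|\cdot\|_{Z_s},\|\cdot\|_{E_s}$, the map $L_r'$ (hence $G$) and the points $z^0,\varepsilon^0$ depend on a parameter $T>0$, the following $T$-uniformity holds: (a) If the convergence in (ii) is uniform in $T$ and $\|G_z(z^0,\varepsilon^0)^{-1}\|_{L(E,Z)}$ is bounded independently of $T$, then $r_Z$ and $r_E$ can be chosen independently of $T$. (b) If, additionally, the convergence in (iii) is uniform in $T$ and $\|G_z(z^0,\varepsilon^0)^{-1}\|_{L(E_s,Z_s)}$ is bounded independently of $T$, then the constant $c$ in $( * )$ is independent of $T$.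
   Context: $L(X,Y)$ denotes the space of bounded linear operators from $X$ to $Y$ with the operator norm. The spaces $Z,E$, their norms $\|\cdot\|_Z,\|\cdot\|_E,\|\cdot\|_{Z_s},\|\cdot\|_{E_s}$, the map $L_r'$ (hence $G$), and the points $z^0,\varepsilon^0$ may all depend on a parameter $T>0$ (the length of the time horizon); the constants in the equivalence of $\|\cdot\|_Z$ with $\|\cdot\|_{Z_s}$ and of $\|\cdot\|_E$ with $\|\cdot\|_{E_s}$ may depend on $T$ as well. That the convergence in (ii) is uniform in $T$ means: for every $\eta>0$ there is $\rho>0$ independent of $T$ such that $\delta_\varepsilon(z^1,z^2)\le\eta$ whenever $\|z^1-z^0\|_Z\le\rho$, $\|z^2-z^0\|_Z\le\rho$, $z^1\neq z^2$ and $\|\varepsilon-\varepsilon^0\|_E\le\rho$; analogously for (iii), where the smallness of $z^1-z^0$ and $\varepsilon-\varepsilon^0$ is again measured in the norms of $Z$ and $E$. *)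

(* Defs.v *)
From HB Require Import structures.
From mathcomp Require Import all_boot all_order all_algebra.
From mathcomp Require Import all_classical all_reals all_analysis.

Set Implicit Arguments.
Unset Strict Implicit.
Unset Printing Implicit Defensive.
Import Order.TTheory GRing.Theory Num.Theory.
Import numFieldNormedType.Exports.
Local Open Scope classical_set_scope.
Local Open Scope ring_scope.

Definition is_norm (R : realType) (V : lmodType R) (n : V -> R) : Prop :=
  [/\ forall x y, n (x + y) <= n x + n y,
      forall (a : R) x, n (a *: x) = `|a| * n x
    & forall x, n x = 0 -> x = 0].

Definition equivalent_norms (R : realType) (V : lmodType R) (n m : V -> R) :
    Prop :=
  exists c C : R, [/\ 0 < c, 0 < C & forall x, c * n x <= m x <= C * n x].

(* Valued in \bar R, so that an unbounded map has norm +oo. *)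
Definition opnorm (R : realType) (V W : lmodType R) (nV : V -> R) (nW : W -> R)
    (A : V -> W) : \bar R :=
  ereal_sup [set (nW (A x))%:E | x in [set x | nV x <= 1]].

(* Z_s and E_s have the carriers of Z and E; only their norms are recorded. *)
Record setting (R : realType) := Setting {
  spZ : completeNormedModType R;
  spE : completeNormedModType R;
  normZs : spZ -> R;
  normEs : spE -> R;
  Lr' : spZ -> spE;
  z0 : spZ;
  eps0 : spE
}.

Definition normZ (R : realType) (P : setting R) (z : spZ P) : R := `|z|.
Definition normE (R : realType) (P : setting R) (e : spE P) : R := `|e|.
Arguments normZ {R} P z.
Arguments normE {R} P e.
Arguments normZs {R} s z : rename.
Arguments normEs {R} s e : rename.
Arguments z0 {R} s : rename.
Arguments eps0 {R} s : rename.

Section Setting.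
Context {R : realType} (P : setting R).

Definition G (z : spZ P) (e : spE P) : spE P := Lr' z - e.

(* The differential 'd f x is unspecified when f is not differentiable at x;
   [standing] below requires differentiability. *)
Definition Gz : spZ P -> spE P := 'd (fun z => G z (eps0 P)) (z0 P).

(* The two-sided inverse of Gz whenever Gz is bijective. *)
Definition Gz_inv : spE P -> spZ P := pinv [set: spZ P] Gz.

Definition standing : Prop :=
  [/\ is_norm (normZs P) /\ equivalent_norms (normZ P) (normZs P),
      is_norm (normEs P) /\ equivalent_norms (normE P) (normEs P),
      G (z0 P) (eps0 P) = 0
    & differentiable (fun z => G z (eps0 P)) (z0 P)].

Definition cond_i : Prop := bijective Gz /\ continuous Gz_inv.

Definition remainder (e : spE P) (z1 z2 : spZ P) : spE P :=
  G z1 e - G z2 e - Gz (z1 - z2).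

Definition delta (e : spE P) (z1 z2 : spZ P) : R :=
  normE P (remainder e z1 z2) / normZ P (z1 - z2).

Definition delta_s (e : spE P) (z1 z2 : spZ P) : R :=
  normEs P (remainder e z1 z2) / normZs P (z1 - z2).

Definition cond_ii : Prop :=
  delta w.2 w.1.1 w.1.2
    @[w --> within [set w : spZ P * spZ P * spE P | w.1.1 != w.1.2]
              (nbhs (z0 P, z0 P, eps0 P))] --> (0 : R).

Definition cond_iii : Prop :=
  delta_s w.2 w.1 (z0 P)
    @[w --> within [set w : spZ P * spE P | w.1 != z0 P]
              (nbhs (z0 P, eps0 P))] --> (0 : R).

Definition solvable_with (rE rZ c : R) : Prop :=
  forall e : spE P, normE P (e - eps0 P) <= rE ->
    exists zs : spZ P,
      [/\ normZ P (zs - z0 P) <= rZ, G zs e = 0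
        & normZs P (zs - z0 P) <= c * normEs P (e - eps0 P)].

End Setting.
Arguments Gz {R} P _.
Arguments Gz_inv {R} P _.

Section Uniformity.
Context {R : realType} (P : {posnum R} -> setting R).

Definition cond_ii_uniform : Prop :=
  forall eta : R, 0 < eta -> exists2 rho : R, 0 < rho &
    forall (T : {posnum R}) (z1 z2 : spZ (P T)) (e : spE (P T)),
      normZ (P T) (z1 - z0 (P T)) <= rho ->
      normZ (P T) (z2 - z0 (P T)) <= rho ->
      z1 != z2 ->
      normE (P T) (e - eps0 (P T)) <= rho ->
      delta e z1 z2 <= eta.

Definition cond_iii_uniform : Prop :=
  forall eta : R, 0 < eta -> exists2 rho : R, 0 < rho &
    forall (T : {posnum R}) (z1 : spZ (P T)) (e : spE (P T)),
      normZ (P T) (z1 - z0 (P T)) <= rho ->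
      z1 != z0 (P T) ->
      normE (P T) (e - eps0 (P T)) <= rho ->
      delta_s e z1 (z0 (P T)) <= eta.

Definition inv_bounded_uniform : Prop :=
  exists M : R, forall T : {posnum R},
    (opnorm (normE (P T)) (normZ (P T)) (Gz_inv (P T)) <= M%:E)%E.

Definition inv_bounded_s_uniform : Prop :=
  exists M : R, forall T : {posnum R},
    (opnorm (normEs (P T)) (normZs (P T)) (Gz_inv (P T)) <= M%:E)%E.

End Uniformity.

(* Main.v *)
Require Import Defs.
From HB Require Import structures.
From mathcomp Require Import all_boot all_order all_algebra.
From mathcomp Require Import all_classical all_reals all_analysis.
From mathcomp Require Import ring lra.

Set Implicit Arguments.
Unset Strict Implicit.
Unset Printing Implicit Defensive.
Import Order.TTheory GRing.Theory Num.Theory.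
Import numFieldNormedType.Exports.
Local Open Scope ring_scope.

(** The equation [G z e = 0] is solved by the simplified Newton map
    [z |-> z - A^-1 (G z e)], where [A] is the derivative [Gz] frozen at the
    base point.  The difference of two of its values is [A^-1] applied to minus
    the remainder that (ii) controls, so once the remainder is at most
    [(2 M)^-1 |z1 - z2|] on a ball of radius [r], with [M] a bound for [A^-1],
    the map is a contraction with constant [1/2] on that ball.  It moves the
    centre by [A^-1 (e - e0)], hence maps the ball to itself as soon as
    [|e - e0| <= r / (2 M)], and Banach's fixed point theorem gives a zero
    ([newton_zero]).  Only [M] and the radius enter, which is the uniformity of
    [rZ] and [rE].

    Since [e] enters [G] additively, every zero satisfies
    [A (z - z0) = (e - e0) - remainder].  Applying [A^-1] and absorbing the
    remainder into the left-hand side gives [|z - z0| <= 2 M |e - e0|], in any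
    pair of norms in which [A^-1] is bounded by [M] and the remainder at [z0]
    by [(2 M)^-1 |z - z0|] ([zero_norm_le]).  In the strong norms this is (b),
    with [c = 2 M].  In the original norms it follows from (ii), and a change
    of norm turns it into (a), with a constant that depends on [T] through
    the equivalence of the norms.  The part without a parameter is (a) for a
    constant family. *)

(** * Norms given as functions *)

Lemma is_norm0 (R : realType) (V : lmodType R) (n : V -> R) :
  is_norm n -> n 0 = 0.
Proof. by case=> _ nZ _; rewrite -(scale0r 0) nZ normr0 mul0r. Qed.

Lemma is_normN (R : realType) (V : lmodType R) (n : V -> R) (x : V) :
  is_norm n -> n (- x) = n x.
Proof. by case=> _ nZ _; rewrite -scaleN1r nZ normrN1 mul1r. Qed.

Lemma is_norm_ge0 (R : realType) (V : lmodType R) (n : V -> R) (x : V) :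
  is_norm n -> 0 <= n x.
Proof.
move=> nn; have [nD _ _] := nn.
by have := nD x (- x); rewrite subrr (is_norm0 nn) (is_normN x nn); lra.
Qed.

Lemma normr_is_norm (R : realType) (V : normedModType R) :
  is_norm (fun x : V => `|x|).
Proof.
split=> [x y|a x|x]; [exact: ler_normD|exact: normrZ|].
exact: normr0_eq0.
Qed.

(** Vectors with [nV x = 0] cannot be rescaled to the unit ball; they are zero by
    definiteness. *)
Lemma opnorm_bound (R : realType) (V W : lmodType R) (nV : V -> R) (nW : W -> R)
    (A : V -> W) (M : R) :
  is_norm nV -> is_norm nW -> (forall a x, A (a *: x) = a *: A x) ->
  (opnorm nV nW A <= M%:E)%E -> forall x, nW (A x) <= M * nV x.
Proof.
move=> nnV nnW AZ AM x.
have [_ nVZ nV0] := nnV; have [_ nWZ _] := nnW.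
have unit_le y : nV y <= 1 -> nW (A y) <= M.
  move=> y1; rewrite -lee_fin; apply: le_trans AM.
  by apply: ereal_sup_ubound; exists y.
have [/eqP x0|x_neq0] := boolP (nV x == 0).
  have A0 : A 0 = 0 by rewrite -(scale0r 0) AZ scale0r.
  by rewrite (nV0 _ x0) A0 (is_norm0 nnV) (is_norm0 nnW) mulr0.
have x_gt0 : 0 < nV x by rewrite lt_neqAle eq_sym x_neq0 is_norm_ge0.
have := unit_le ((nV x)^-1 *: x).
rewrite AZ nVZ nWZ gtr0_norm ?invr_gt0// mulVf// lexx => /(_ isT).
by rewrite mulrC ler_pdivrMr.
Qed.

Lemma continuous_opnorm_bounded (R : realType) (V W : normedModType R) (A : V -> W) :
  (forall a x, A (a *: x) = a *: A x) -> continuous A ->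
  exists M : R,
    (opnorm (fun x : V => `|x|%R) (fun y : W => `|y|%R) A <= M%:E)%E.
Proof.
move=> AZ Ac; have A0 : A 0 = 0 by rewrite -(scale0r 0) AZ scale0r.
have /cvgrPdist_le/(_ 1 ltr01)/nbhs_ballP[d /= d0 Hd] := Ac 0.
exists (d / 2)^-1; apply: ge_ereal_sup => _ /= [x x1 <-]; rewrite lee_fin.
have d2 : 0 < d / 2 by lra.
have := Hd ((d / 2) *: x).
rewrite -ball_normE /= A0 !sub0r !normrN AZ !(normrZ (d / 2))
  (gtr0_norm d2) => Hx.
rewrite -[leRHS]mul1r ler_pdivlMr// mulrC; apply: Hx; nra.
Qed.

(** * Linearity of the inverse derivative *)

Lemma GzB (R : realType) (P : setting R) (x y : spZ P) :
  Gz P (x - y) = Gz P x - Gz P y.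
Proof. exact: linearB. Qed.

Lemma GzZ (R : realType) (P : setting R) (a : R) (x : spZ P) :
  Gz P (a *: x) = a *: Gz P x.
Proof. exact: linearZ. Qed.

Lemma Gz_invK (R : realType) (P : setting R) :
  bijective (Gz P) -> cancel (Gz_inv P) (Gz P).
Proof.
move=> [g _ gK] y; rewrite /Gz_inv pinvK// inE /=.
by exists (g y).
Qed.

Lemma GzK (R : realType) (P : setting R) :
  bijective (Gz P) -> cancel (Gz P) (Gz_inv P).
Proof. by move=> b x; apply: (bij_inj b); rewrite Gz_invK. Qed.

Lemma Gz_invB (R : realType) (P : setting R) (x y : spE P) :
  bijective (Gz P) -> Gz_inv P (x - y) = Gz_inv P x - Gz_inv P y.
Proof. by move=> b; apply: (bij_inj b); rewrite GzB !Gz_invK. Qed.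

Lemma Gz_invZ (R : realType) (P : setting R) :
  bijective (Gz P) ->
  forall (a : R) (x : spE P), Gz_inv P (a *: x) = a *: Gz_inv P x.
Proof.
move=> b a x; apply: (bij_inj b); rewrite Gz_invK//.
by rewrite GzZ Gz_invK.
Qed.

(** * Existence of a zero and its distance to the base point *)

Lemma remainder_diag (R : realType) (P : setting R) (e : spE P) (z : spZ P) :
  remainder e z z = 0.
Proof. by rewrite /remainder GzB !subrr. Qed.

(** The quotients in (ii) and (iii) say nothing on the diagonal, where the
    remainder vanishes. *)
Lemma remainder_le (R : realType) (P : setting R) (nZ : spZ P -> R)
    (nE : spE P -> R) (e : spE P) (z1 z2 : spZ P) (eta : R) :
  is_norm nZ -> is_norm nE ->
  (z1 != z2 -> nE (remainder e z1 z2) / nZ (z1 - z2) <= eta) ->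
  nE (remainder e z1 z2) <= eta * nZ (z1 - z2).
Proof.
move=> nnZ nnE H; have [->|z12] := eqVneq z1 z2.
  by rewrite remainder_diag subrr (is_norm0 nnZ) (is_norm0 nnE) mulr0.
have nz : 0 < nZ (z1 - z2).
  rewrite lt_neqAle is_norm_ge0// andbT eq_sym; apply: contra z12 => /eqP.
  by have [_ _ n0] := nnZ => /n0/eqP; rewrite subr_eq0.
by rewrite -ler_pdivrMr//; exact: H.
Qed.

Lemma remainder_indep (R : realType) (P : setting R) (e e' : spE P)
    (z1 z2 : spZ P) :
  remainder e z1 z2 = remainder e' z1 z2.
Proof. by rewrite /remainder /G !opprB !addrA !subrK. Qed.

(** As [e] cancels in the remainder, the bound at the base point covers the
    maps for all [e]. *)
Lemma newton_zero (R : realType) (P : setting R) (M r : R) (e : spE P) :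
  0 < M -> 0 < r -> bijective (Gz P) -> G (z0 P) (eps0 P) = 0 ->
  (forall y, `|Gz_inv P y| <= M * `|y|) ->
  (forall z1 z2, `|z1 - z0 P| <= r -> `|z2 - z0 P| <= r ->
    `|remainder (eps0 P) z1 z2| <= (2 * M)^-1 * `|z1 - z2|) ->
  `|e - eps0 P| <= r / (2 * M) ->
  exists2 z, `|z - z0 P| <= r & G z e = 0.
Proof.
move=> M0 r0 b G0 AM rem er.
pose U : set (spZ P) := closed_ball_ Num.norm (z0 P) r.
pose f z := z - Gz_inv P (G z e).
have f_lip z1 z2 : `|z1 - z0 P| <= r -> `|z2 - z0 P| <= r ->
    `|f z1 - f z2| <= 2^-1 * `|z1 - z2|.
  move=> z1r z2r.
  have -> : f z1 - f z2 = - Gz_inv P (remainder (eps0 P) z1 z2).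
    rewrite (remainder_indep (eps0 P) e) /remainder Gz_invB// GzK//.
    by rewrite Gz_invB// /f !opprB addrACA [RHS]addrACA [- z2 + _]addrC.
  rewrite normrN (le_trans (AM _))//.
  apply: (le_trans (ler_wpM2l (ltW M0) (rem _ _ z1r z2r))).
  by rewrite mulrA invfM mulrCA divff ?mulr1// gt_eqF.
have f_center : `|f (z0 P) - z0 P| <= r / 2.
  rewrite /f [_ - _ - _]addrAC subrr sub0r normrN (le_trans (AM _))//.
  have -> : G (z0 P) e = - (e - eps0 P).
    by rewrite opprB; apply/eqP; rewrite -subr_eq0 -G0 /G opprB addrA subrK.
  rewrite normrN; apply: (le_trans (ler_wpM2l (ltW M0) er)).
  by rewrite le_eqVlt; apply/orP; left; apply/eqP; field; lra.
have f_stable z : U z -> U (f z).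
  rewrite /U /closed_ball_ /= ![`|z0 P - _|]distrC => zr.
  rewrite -(subrKA (f (z0 P))) (le_trans (ler_normD _ _))//.
  have := f_lip z (z0 P) zr; rewrite subrr normr0 => /(_ (ltW r0)); lra.
have f_fun : set_fun U U f by [].
pose F : {fun U >-> U} := mkfun f_fun.
have Fc : is_contraction F.
  exists 2^-1%:nng; split; first by rewrite /=; lra.
  move=> [z1 z2] /= [+ +]; rewrite /U /closed_ball_ /= ![`|z0 P - _|]distrC.
  exact: f_lip.
have Ucl : closed U by exact: closed_closed_ball_.
have [|z Uz zf] := banach_fixed_point Fc Ucl.
  by exists (z0 P); rewrite /U /closed_ball_ /= subrr normr0 ltW.
exists z; first by move: Uz; rewrite /U /closed_ball_ /= distrC.
have /eqP : Gz_inv P (G z e) = 0.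
  by move: zf; rewrite /= /f => /eqP; rewrite eq_sym -subr_eq0 addrAC subrr
    sub0r oppr_eq0 => /eqP.
by move=> /eqP /(congr1 (Gz P)); rewrite Gz_invK// => ->; exact: linear0.
Qed.

(** [z - z0] equals [A^-1 (e - e0 - remainder)], and the remainder contributes at
    most half of [nZ (z - z0)].  The norms are arbitrary because the estimate is
    needed in the original and in the strong ones. *)
Lemma zero_norm_le (R : realType) (P : setting R) (nZ : spZ P -> R)
    (nE : spE P -> R) (M : R) (e : spE P) (z : spZ P) :
  is_norm nE -> 0 < M -> bijective (Gz P) -> G (z0 P) (eps0 P) = 0 ->
  (forall y, nZ (Gz_inv P y) <= M * nE y) ->
  nE (remainder e z (z0 P)) <= (2 * M)^-1 * nZ (z - z0 P) ->
  G z e = 0 -> nZ (z - z0 P) <= 2 * M * nE (e - eps0 P).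
Proof.
move=> nnE M0 b G0 AM rem Gz0; have [nED _ _] := nnE.
have Gh : Gz P (z - z0 P) = (e - eps0 P) - remainder e z (z0 P).
  have -> : e - eps0 P = - G (z0 P) e.
    by rewrite /G opprB; move/eqP: G0; rewrite /G subr_eq0 => /eqP ->.
  by rewrite /remainder Gz0 sub0r subKr.
have := AM (Gz P (z - z0 P)); rewrite GzK//.
have := nED (e - eps0 P) (- remainder e z (z0 P)); rewrite -Gh is_normN//.
set h := nZ _ => le1 le2.
have {}rem : M * nE (remainder e z (z0 P)) <= 2^-1 * h.
  apply: (le_trans (ler_wpM2l (ltW M0) rem)).
  by rewrite invfM -mulrA mulrCA mulVKf ?gt_eqF.
have := ler_wpM2l (ltW M0) le1; rewrite mulrDr; lra.
Qed.

(** * Uniformity in the parameter *)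

(** Requiring the bound to be positive makes it available as a divisor. *)
Lemma inv_bound_pos (R : realType) (P : {posnum R} -> setting R)
    (nE : forall T, spE (P T) -> R) (nZ : forall T, spZ (P T) -> R) :
  (forall T, bijective (Gz (P T))) ->
  (forall T, is_norm (nE T)) -> (forall T, is_norm (nZ T)) ->
  (exists M : R, forall T, (opnorm (nE T) (nZ T) (Gz_inv (P T)) <= M%:E)%E) ->
  exists2 M : R, 0 < M &
    forall T y, nZ T (Gz_inv (P T) y) <= M * nE T y.
Proof.
move=> b nnE nnZ [M AM]; exists (Num.max M 1); first by rewrite lt_max ltr01 orbT.
move=> T y; have := opnorm_bound (nnE T) (nnZ T) (Gz_invZ (b T)) (AM T) y.
move=> /le_trans; apply; apply: ler_wpM2r; first exact: is_norm_ge0.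
by rewrite le_max lexx.
Qed.

(** Every smaller radius [rho] works as well; this lets [rho] be shrunk to the
    range in which the remainder is also small in the strong norms. *)
Lemma uniform_zeros (R : realType) (P : {posnum R} -> setting R) :
  (forall T, standing (P T) /\ cond_i (P T)) ->
  cond_ii_uniform P -> inv_bounded_uniform P ->
  exists2 M : R, 0 < M & exists2 r : R, 0 < r &
    forall (rho : R), 0 < rho -> rho <= r ->
    forall (T : {posnum R}) (e : spE (P T)),
      `|e - eps0 (P T)| <= rho / (2 * M) ->
      exists z : spZ (P T), [/\ `|z - z0 (P T)| <= rho, G z e = 0 &
        `|z - z0 (P T)| <= 2 * M * `|e - eps0 (P T)|].
Proof.
move=> hyp ii iM.
have b T : bijective (Gz (P T)) by have [_ []] := hyp T.
have [M M0 AM] := inv_bound_pos (P := P) b (fun T => normr_is_norm (spE (P T)))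
  (fun T => normr_is_norm (spZ (P T))) iM.
have [r r0 rem] := ii (2 * M)^-1 ltac:(by rewrite invr_gt0; lra).
exists M => //; exists r => // rho rho0 rho_r T e eM.
have [[_ _ G0 _] _] := hyp T.
have remT z1 z2 : `|z1 - z0 (P T)| <= rho -> `|z2 - z0 (P T)| <= rho ->
    `|remainder (eps0 (P T)) z1 z2| <= (2 * M)^-1 * `|z1 - z2|.
  move=> z1r z2r; apply: (@remainder_le _ _ (fun x => `|x|) (fun x => `|x|));
    [exact: normr_is_norm|exact: normr_is_norm|move=> z12].
  apply: (rem T) => //; [exact: le_trans rho_r|exact: le_trans rho_r|].
  by rewrite /normE subrr normr0 ltW.
have [z zr Gz0] := newton_zero M0 rho0 (b T) G0 (AM T) remT eM.
exists z; split=> //.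
apply: (@zero_norm_le _ _ (fun x => `|x|) (fun x => `|x|) M e z) => //;
  [exact: normr_is_norm|exact: AM|].
rewrite (remainder_indep e (eps0 (P T))).
by apply: remT => //; rewrite subrr normr0 ltW.
Qed.

(** The estimate in the original norms holds for all [e] within the common radius
    [rE]; passing to the strong norms costs the equivalence constants of [T]. *)
Lemma solvable_uniform_radii (R : realType) (P : {posnum R} -> setting R) :
  (forall T, standing (P T) /\ cond_i (P T)) ->
  cond_ii_uniform P -> inv_bounded_uniform P ->
  exists rE rZ : R, [/\ 0 < rE, 0 < rZ &
    forall T : {posnum R}, exists c : R, solvable_with (P T) rE rZ c].
Proof.
move=> hyp ii iM; have [M M0 [r r0 zeros]] := uniform_zeros hyp ii iM.
exists (r / (2 * M)), r; split=> //; first by rewrite divr_gt0//; lra.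
move=> T.
have [[[_ [c1 [C1 [_ C10 eqZ]]]] [_ [c2 [C2 [c20 _ eqE]]]] _ _] _] := hyp T.
exists (C1 * (2 * M) / c2) => e er.
have [z [zr Gz0 ze]] := zeros r r0 (lexx r) T e er.
exists z; split=> //.
have /andP[_ zs] := eqZ (z - z0 (P T)); have /andP[es _] := eqE (e - eps0 (P T)).
apply: (le_trans zs); rewrite -!mulrA ler_pM2l//.
apply: (le_trans ze); rewrite -mulrA; do 2! [rewrite ler_pM2l//].
by rewrite mulrC ler_pdivlMr// mulrC.
Qed.

Lemma solvable_uniform_constant (R : realType) (P : {posnum R} -> setting R) :
  (forall T, standing (P T) /\ cond_i (P T)) ->
  cond_ii_uniform P -> inv_bounded_uniform P ->
  cond_iii_uniform P -> inv_bounded_s_uniform P ->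
  exists rE rZ c : R, [/\ 0 < rE, 0 < rZ &
    forall T : {posnum R}, solvable_with (P T) rE rZ c].
Proof.
move=> hyp ii iM iii isM.
have b T : bijective (Gz (P T)) by have [_ []] := hyp T.
have nnE T : is_norm (normEs (P T)) by have [[_ [] []]] := hyp T.
have nnZ T : is_norm (normZs (P T)) by have [[[]]] := hyp T.
have [M M0 [r r0 zeros]] := uniform_zeros hyp ii iM.
have [Ms Ms0 AMs] := inv_bound_pos (P := P) b nnE nnZ isM.
have [rs rs0 rem] := iii (2 * Ms)^-1 ltac:(by rewrite invr_gt0; lra).
pose rho := Num.min r rs.
have rho0 : 0 < rho by rewrite lt_min r0.
have rho_r : rho <= r by rewrite ge_min lexx.
have rho_rs : rho <= rs by rewrite ge_min lexx orbT.
have M2 : 0 < 2 * M by lra.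
exists (rho / (2 * M)), rho, (2 * Ms); split=> //; first exact: divr_gt0.
move=> T e er.
have [[_ _ G0 _] _] := hyp T.
have [z [zr Gz0 _]] := zeros rho rho0 rho_r T e er.
exists z; split=> //.
apply: (@zero_norm_le _ _ (normZs (P T)) (normEs (P T)) Ms e z) => //.
rewrite (remainder_indep e (eps0 (P T))); apply: remainder_le => // zz0.
apply: (rem T) => //; first exact: le_trans rho_rs.
by rewrite /normE subrr normr0 ltW.
Qed.

Lemma cond_ii_uniform_const (R : realType) (P : setting R) :
  cond_ii P -> cond_ii_uniform (fun=> P).
Proof.
move=> ii eta eta0.
have /cvgrPdist_le/(_ eta eta0) := ii.
rewrite /= => /nbhs_ballP[d /= d0 Hd].
exists (d / 2); first by lra.
move=> _ z1 z2 e; rewrite /normZ /normE => z1d z2d z12 ed.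
have in_ball (V : normedModType R) (x y : V) : `|x - y| <= d / 2 -> ball y d x.
  by move=> xy; rewrite -ball_normE /= distrC; lra.
have := Hd (z1, z2, e).
rewrite /= sub0r normrN => /(_ _ z12).
move=> H; apply: (le_trans (ler_norm _)); apply: H.
by split; [split|]; exact: in_ball.
Qed.

Lemma inv_bounded_uniform_const (R : realType) (P : setting R) :
  cond_i P -> inv_bounded_uniform (fun=> P).
Proof.
by move=> [b Ac]; have [M AM] := continuous_opnorm_bounded (Gz_invZ b) Ac; exists M.
Qed.

Theorem theorem1 (R : realType) :
  (forall P : setting R,
     standing P -> cond_i P -> cond_ii P -> cond_iii P ->
     exists rE rZ c : R, [/\ 0 < rE, 0 < rZ & solvable_with P rE rZ c])
  /\
  (forall P : {posnum R} -> setting R,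
     (forall T : {posnum R},
        [/\ standing (P T), cond_i (P T), cond_ii (P T) & cond_iii (P T)]) ->
     cond_ii_uniform P -> inv_bounded_uniform P ->
     (exists rE rZ : R, [/\ 0 < rE, 0 < rZ &
        forall T : {posnum R}, exists c : R, solvable_with (P T) rE rZ c])
     /\
     (cond_iii_uniform P -> inv_bounded_s_uniform P ->
      exists rE rZ c : R, [/\ 0 < rE, 0 < rZ &
        forall T : {posnum R}, solvable_with (P T) rE rZ c])).
Proof.
split=> [P st i ii _|P hyp ii iM].
  have [//|rE [rZ [rE0 rZ0 /(_ 1%:pos)[c sol]]]] :=
    @solvable_uniform_radii R (fun=> P) _ (cond_ii_uniform_const ii)
      (inv_bounded_uniform_const i).
  by exists rE, rZ, c.
have hyp' T : standing (P T) /\ cond_i (P T) by have [] := hyp T.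
split=> [|iii isM]; first exact: solvable_uniform_radii.
exact: solvable_uniform_constant.
Qed.
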